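(* Let $G$ be an infinite torsion-free abelian group and let $G = A \oplus H$ with $A$ completely decomposable and $H$ clipped. If $G = A' \oplus H'$ is any decomposition with $A'$ completely decomposable and $H'$ clipped, then the rank of $H'$ is equal to the rank of $H$.
   Context: A torsion-free abelian group is completely decomposable if it is a direct sum (possibly infinite, possibly empty) of groups of rank $1$. A torsion-free abelian group $H$ is clipped if it has no direct summand of rank $1$. The rank of a torsion-free abelian group is the cardinality of a maximal linearly independent (over $\mathbb{Z}$) subset. *)

(* Defs.v *)
From mathcomp Require Import all_boot all_order all_algebra.
From mathcomp Require Import boolp classical_sets functions cardinality.

Set Implicit Arguments.
Unset Strict Implicit.
Unset Printing Implicit Defensive.

Import GRing.Theory.
Local Open Scope classical_set_scope.
Local Open Scope card_scope.
Local Open Scope ring_scope.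

(* Subgroups of an abelian group [G : zmodType] are sets [H : set G], and
   direct sums are internal. *)

Section AbelianGroups.
Variable G : zmodType.
Implicit Types (A B C D H : set G).

Definition torsion_free : Prop :=
  forall (n : nat) (x : G), (0 < n)%N -> x *+ n = 0 -> x = 0.

Definition is_subgroup H : Prop := zmod_closed [in H].

Definition direct_sum A B D : Prop :=
  [/\ is_subgroup A, is_subgroup B, A `&` B = [set 0] &
      D = [set a + b | a in A & b in B]].

(* [D] is the internal direct sum of the possibly infinite family [F]; for an
   empty index type this says that [D] is the zero subgroup. *)
Definition direct_sum_family (I : choiceType) (F : I -> set G) D : Prop :=
  [/\ forall i, is_subgroup (F i),
      D = [set x | exists (s : seq I) (f : I -> G),
             (forall i, F i (f i)) /\ x = \sum_(i <- s) f i] &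
      forall (s : seq I) (f : I -> G), uniq s -> (forall i, F i (f i)) ->
        \sum_(i <- s) f i = 0 -> forall i, i \in s -> f i = 0].

Definition Z_independent B : Prop :=
  forall (s : seq G) (c : G -> int), uniq s -> (forall x, x \in s -> B x) ->
    \sum_(x <- s) x *~ c x = 0 -> forall x, x \in s -> c x = 0.

Definition maximal_independent H B : Prop :=
  [/\ B `<=` H, Z_independent B &
      forall C, B `<=` C -> C `<=` H -> Z_independent C -> C = B].

(* Maximal independent subsets always exist, see [ex_maximal_independent], so
   the universal quantification below is never vacuous. *)
Definition same_rank H H' : Prop :=
  forall B B', maximal_independent H B -> maximal_independent H' B' -> B #= B'.

Definition rank_one H : Prop := exists x, maximal_independent H [set x].

Definition completely_decomposable A : Prop :=
  exists (I : choiceType) (F : I -> set G),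
    (forall i, rank_one (F i)) /\ direct_sum_family F A.

Definition clipped H : Prop :=
  ~ exists B C, direct_sum B C H /\ rank_one B.

Lemma ex_maximal_independent H : exists B, maximal_independent H B.
Proof.
pose P B := B `<=` H /\ Z_independent B.
have chainP (F : set (set G)) : F `<=` P -> total_on F subset ->
    P (\bigcup_(X in F) X).
  move=> FP Ftot; split; first by move=> x [X /FP [XH _]] /XH.
  case=> [|x0 s] c us sF sum0 x xs; first by [].
  have [X FX sX] : exists2 X, F X & forall x, x \in x0 :: s -> X x.
    elim: s x0 {us sum0 xs} sF => [|y s IHs] x0 sF.
      have [X FX Xx] := sF x0 (mem_head _ _).
      by exists X => // z; rewrite inE => /eqP ->.
    have [|X FX sX] := IHs y; first by move=> z zs; apply: sF; rewrite inE zs orbT.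
    have [Y FY Yx] := sF x0 (mem_head _ _).
    have [XY|YX] := Ftot _ _ FX FY.
      by exists Y => // z; rewrite inE => /predU1P [->//|/sX /XY].
    by exists X => // z; rewrite inE => /predU1P [->|/sX//]; exact: YX.
  by have [_ indX] := FP _ FX; exact: (indX _ _ us sX sum0).
have [B [[BH indB] maxB]] := Zorn_bigcup chainP.
exists B; split=> // C BC CH indC; apply: contrapT => CB.
apply: (maxB C); last by split.
by split=> // CsB; apply: CB; apply/seteqP.
Qed.

End AbelianGroups.

(* Main.v *)
From HB Require Import structures.
Require Import Defs.
From mathcomp Require Import all_boot all_order all_algebra.
From mathcomp Require Import boolp classical_sets functions cardinality.
From mathcomp Require Import zify ring.

(* The heart of the matter is that [A] and [H'] meet trivially. Suppose that
   [x <> 0] lies in both, and write [x] as a sum of components [x_i] in rank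
   one summands [A_i] of [A]. Fix [i] such that the type of [x_i] is minimal,
   let [T] be the set of [j] such that the type of [x_j] is at most that of
   [x_i], and let [v] be the projection to [H'] of the sum of the [x_j] over
   [T]. A homomorphism from [A_j] to [A_k] is zero at [x_j] unless the type of
   [x_j] is at most that of [x_k], so, [x] being its own projection to [H'],
   [v] has the component [x_k] in [A_k] for every [k] in [T]. Then [n] divides
   [v] iff [n] divides all these [x_k]; one prime at a time, this gives integers [q_k] of sum [1] such that
   [x_k |-> q_k v] extends to [A_k]. Summing these maps yields a retraction of
   [H'] onto the pure subgroup generated by [v], which is a direct summand of
   rank one, against [H'] being clipped.
   Therefore the projection to [H] along [A] is injective on [H'], and
   symmetrically, so the two ranks bound each other. *)

Set Implicit Arguments.
Unset Strict Implicit.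
Unset Printing Implicit Defensive.

Import Order.TTheory GRing.Theory Num.Theory.
Local Open Scope classical_set_scope.
Local Open Scope card_scope.
Local Open Scope ring_scope.

Lemma big_uniq_support (I : eqType) (V : nmodType) (s s' : seq I) (f : I -> V) :
  uniq s -> uniq s' -> {subset s <= s'} -> (forall i, i \notin s -> f i = 0) ->
  \sum_(i <- s') f i = \sum_(i <- s) f i.
Proof.
move=> us us' ss' f0; rewrite (bigID (mem s)) /= [X in _ + X]big1 // addr0.
rewrite -big_filter; apply/perm_big/uniq_perm => //; first exact: filter_uniq.
by move=> i; rewrite mem_filter; case: (boolP (i \in s)) => //= /ss'.
Qed.

Lemma int_subgroup_1 (K : int -> Prop) :
  (forall k l, K k -> K l -> K (k - l)) ->
  (forall p : nat, prime p -> exists2 k : int, K k & ~~ (p%:Z %| k)%Z) -> K 1.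
Proof.
move=> KB Kp.
have [k0 Kk0 _] := Kp 2%N isT.
have K0 : K 0 by rewrite -(subrr k0); exact: KB.
have KN k : K k -> K (- k) by move=> Kk; rewrite -sub0r; exact: KB.
have KD k l : K k -> K l -> K (k + l).
  by move=> Kk Kl; rewrite -[l]opprK; exact/KB/KN.
have KMn k (n : nat) : K k -> K (n%:Z * k).
  move=> Kk; elim: n => [|n IHn]; first by rewrite mul0r.
  by rewrite -addn1 PoszD mulrDl mul1r; exact: KD.
have KM l k : K k -> K (l * k).
  by case: l => n Kk; rewrite ?NegzE ?mulNr; [|apply: KN]; exact: KMn.
have Kabs k : K k -> K `|k|%N%:Z.
  by case: k => n // Kk; rewrite -[Posz _]opprK; exact: (KN _ Kk).
have [m m_gt0 Km] : exists2 m : nat, (0 < m)%N & K m%:Z.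
  have [k Kk k2] := Kp 2%N isT.
  exists `|k|%N; last exact: Kabs Kk.
  by rewrite absz_gt0; apply: contraNneq k2 => ->; rewrite dvdz0.
elim/ltn_ind: m m_gt0 Km => m IHm m_gt0 Km.
have [m_le1|m_gt1] := leqP m 1;
  first by rewrite -(_ : m%:Z = 1) // (@anti_leq m 1) // m_le1.
have [k Kk pk] := Kp _ (pdiv_prime m_gt1).
have [u [v uv]] := Bezoutz m%:Z k.
apply: (IHm (gcdn m `|k|)).
- rewrite ltn_neqAle dvdn_leq ?dvdn_gcdl // andbT.
  apply: contra pk => /eqP gm; rewrite /dvdz /= -[pdiv m]/(`|pdiv m|%N).
  by apply: (dvdn_trans (pdiv_dvd m)); rewrite -{1}gm dvdn_gcdr.
- by rewrite gcdn_gt0 m_gt0.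
by rewrite -[X in K X]/(gcdz m k) -uv; apply: KD; exact: KM.
Qed.

Section Groups.
Variable G : zmodType.
Implicit Types (A B C D H P : set G) (x y z g : G).

Lemma is_subgroupP H :
  is_subgroup H <-> H 0 /\ forall x y, H x -> H y -> H (x - y).
Proof.
split=> [[H0 HB]|[H0 HB]].
  split=> [|x y Hx Hy]; first exact/set_mem.
  by apply/set_mem/HB; exact/mem_set.
split; first exact/mem_set.
by move=> x y /set_mem Hx /set_mem Hy; apply/mem_set/HB.
Qed.

Section Subgroup.
Variables (H : set G) (sgH : is_subgroup H).

Lemma subgroup0 : H 0. Proof. by case/is_subgroupP: sgH. Qed.

Lemma subgroupB x y : H x -> H y -> H (x - y).
Proof. by case/is_subgroupP: sgH => _; exact. Qed.

Lemma subgroupN x : H x -> H (- x).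
Proof. by rewrite -sub0r; apply: subgroupB; exact: subgroup0. Qed.

Lemma subgroupD x y : H x -> H y -> H (x + y).
Proof. by move=> Hx Hy; rewrite -[y]opprK; apply/subgroupB/subgroupN. Qed.

Lemma subgroup_sum (I : eqType) (s : seq I) (f : I -> G) :
  (forall i, i \in s -> H (f i)) -> H (\sum_(i <- s) f i).
Proof.
move=> Hf; rewrite big_seq; apply: big_ind => //; first exact: subgroup0.
exact: subgroupD.
Qed.

Lemma subgroupMn x n : H x -> H (x *+ n).
Proof.
move=> Hx; elim: n => [|n IHn]; first exact: subgroup0.
by rewrite mulrS; exact: subgroupD.
Qed.

Lemma subgroupMz x k : H x -> H (x *~ k).
Proof.
by case: k => n Hx; [|rewrite NegzE mulrNz; apply: subgroupN];
  exact: subgroupMn.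
Qed.

End Subgroup.

Lemma additive_of_morphism (f : G -> G) :
  (forall x y, f (x - y) = f x - f y) ->
  exists h : {additive G -> G}, h =1 f.
Proof.
move=> fB.
pose fM := GRing.isZmodMorphism.Build _ _ f fB.
pose h : {additive G -> G} := HB.pack f fM.
by exists h.
Qed.

Lemma direct_sumC A B D : direct_sum A B D -> direct_sum B A D.
Proof.
move=> [sA sB AB ->]; split=> //; first by rewrite setIC.
by apply/seteqP; split=> _ [a ? [b ? <-]]; exists b => //; exists a => //;
  rewrite addrC.
Qed.

Lemma direct_sum_proj A B : direct_sum A B [set: G] ->
  exists e : {additive G -> G}, [/\ forall g, A (e g), forall g, B (g - e g),
    forall a, A a -> e a = a & forall b, B b -> e b = 0].
Proof.
move=> [sA sB AB defG].
have /choice[e eP] g : exists a, A a /\ B (g - a).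
  have : [set a + b | a in A & b in B] g by rewrite -defG.
  by case=> a Aa [b Bb <-]; exists a; split=> //; rewrite addrC addKr.
have uniq_e g a : A a -> B (g - a) -> e g = a.
  move=> Aa Bga; have [Aeg Bgeg] := eP g; apply/subr0_eq.
  have : (A `&` B) (e g - a).
    split; first exact: subgroupB.
    rewrite (_ : e g - a = (g - a) - (g - e g)); first exact: subgroupB.
    by rewrite opprB [RHS]addrC addrA subrK.
  by rewrite AB.
have [|h he] := @additive_of_morphism e.
  move=> x y; have [Ax Bx] := eP x; have [Ay By] := eP y.
  apply: uniq_e; first exact: subgroupB.
  by rewrite opprD opprK addrACA -[- y + _]opprK opprD opprK; exact: subgroupB.
exists h; split=> g; rewrite he; [by case: (eP g)|by case: (eP g)| |].
  by move=> Ag; apply: uniq_e => //; rewrite subrr; exact: subgroup0.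
by move=> Bg; apply: uniq_e; rewrite ?subr0 //; exact: subgroup0.
Qed.

Lemma direct_sum_family_proj (I : choiceType) (F : I -> set G) A H :
  direct_sum A H [set: G] -> direct_sum_family F A ->
  exists c : I -> {additive G -> G}, (forall i g, F i (c i g)) /\
    forall a, A a -> exists s, [/\ uniq s, forall i, i \notin s -> c i a = 0 &
                                a = \sum_(i <- s) c i a].
Proof.
move=> [sA sH AH defG] [sF defA indF].
pose rel g (f : I -> G) := (forall i, F i (f i)) /\ exists s,
  [/\ uniq s, forall i, i \notin s -> f i = 0 & H (g - \sum_(i <- s) f i)].
have relB g g' f f' : rel g f -> rel g' f' -> rel (g - g') (fun i =>
  f i - f' i).
  move=> [Ff [s [us f0 Hs]]] [Ff' [s' [us' f0' Hs']]].
  split=> [i|]; first exact: subgroupB.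
  exists (undup (s ++ s')); split; first exact: undup_uniq.
    by move=> i; rewrite mem_undup mem_cat negb_or => /andP[/f0 -> /f0' ->];
      rewrite subr0.
  rewrite sumrB (@big_uniq_support _ _ s) ?undup_uniq //; last first.
    by move=> i; rewrite mem_undup mem_cat => ->.
  rewrite (@big_uniq_support _ _ s' (undup _)) ?undup_uniq //; last first.
    by move=> i; rewrite mem_undup mem_cat orbC => ->.
  rewrite (_ : _ - _ = (g - \sum_(i <- s) f i) - (g' - \sum_(i <- s') f' i)).
    exact: subgroupB.
  by rewrite !opprD !opprK addrACA.
have rel0 f : rel 0 f -> forall i, f i = 0.
  move=> [Ff [s [us f0 Hs]]] i.
  have [si|/f0//] := boolP (i \in s).
  apply: (indF s f us Ff) => //.
  have : (A `&` H) (\sum_(i <- s) f i).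
    split; first by rewrite defA; exists s, f.
    by rewrite -[X in H X]opprK -[X in - X]add0r; exact: subgroupN.
  by rewrite AH.
have /choice[c cP] g : exists f, rel g f.
  have : [set a + b | a in A & b in H] g by rewrite -defG.
  case=> a; rewrite defA => -[s [f [Ff ->]]] [h Hh <-].
  exists (fun i => f i *+ count_mem i s); split=> [i|]; first exact: subgroupMn.
  exists (undup s); split; first exact: undup_uniq.
    by move=> i; rewrite mem_undup => /count_memPn ->.
  rewrite (_ : \sum_(i <- s) f i = \sum_(i <- undup s) f i *+ count_mem i s).
    by rewrite addrC addKr.
  by rewrite big_undup_iterop_count.
have /choice[h hP] i : exists h : {additive G -> G}, forall g, h g = c g i.
  have [|h hc] := @additive_of_morphism (fun g => c g i); last by exists h.
  move=> x y; apply/subr0_eq.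
  have := relB _ _ _ _ (cP (x - y)) (relB _ _ _ _ (cP x) (cP y)).
  by rewrite subrr => /rel0 /(_ i).
exists h; split=> [i g|a Aa]; first by rewrite hP; case: (cP g).
have [Fc [s [us c0 Hs]]] := cP a; exists s; split=> //.
  by move=> i /c0; rewrite hP.
under eq_bigr do rewrite hP.
apply/subr0_eq.
have : (A `&` H) (a - \sum_(i <- s) c a i).
  split=> //; apply: subgroupB => //; rewrite defA.
  by exists s, (c a).
by rewrite AH.
Qed.
End Groups.

Lemma exists_minimal (I : eqType) (le : I -> I -> Prop) (s : seq I) :
  (forall i, le i i) -> (forall i j k, le i j -> le j k -> le i k) ->
  s != [::] -> exists2 i, i \in s & forall j, j \in s -> le j i -> le i j.
Proof.
move=> lexx le_trans; elim: s => [//|a [|b s] IHs] _.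
  by exists a => [|j]; rewrite mem_seq1 // => /eqP ->.
have [//|i si i_min] := IHs.
have [le_ai|not_le_ai] := pselect (le a i); last first.
  exists i => [|j]; first by rewrite inE si orbT.
  by rewrite inE => /predU1P[->|/i_min].
exists a => [|j]; first exact: mem_head.
rewrite inE => /predU1P[->//|sj le_ja].
exact/(le_trans _ _ _ le_ai)/i_min/(le_trans _ _ _ le_ja).
Qed.

Section Divisibility.
Variable G : zmodType.
Implicit Types (x y z g : G) (n m : nat) (k l : int).

Definition divides n x := exists w, x = w *+ n.

Lemma dividesMz n x k : divides n x -> divides n (x *~ k).
Proof. by move=> [w ->]; exists (w *~ k); rewrite !pmulrn mulrzAC. Qed.

Lemma dividesMn n x m : divides n x -> divides n (x *+ m).
Proof. by move=> /(@dividesMz n x m). Qed.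

Lemma dividesD n x y : divides n x -> divides n y -> divides n (x + y).
Proof. by move=> [w ->] [w' ->]; exists (w + w'); rewrite mulrnDl. Qed.

Lemma dividesB n x y : divides n x -> divides n y -> divides n (x - y).
Proof. by move=> [w ->] [w' ->]; exists (w - w'); rewrite mulrnBl. Qed.

Lemma divides0 n : divides n (0 : G).
Proof. by exists 0; rewrite mul0rn. Qed.

Lemma divides_sum (I : eqType) (s : seq I) (f : I -> G) n :
  (forall i, i \in s -> divides n (f i)) -> divides n (\sum_(i <- s) f i).
Proof.
move=> nf; rewrite big_seq; apply: big_ind => //; first exact: divides0.
by move=> x y; exact: dividesD.
Qed.

Lemma divides_dvdn n m x : (m %| n)%N -> divides n x -> divides m x.
Proof. by move=> /dvdnP[q ->] [w ->]; exists (w *+ q); rewrite mulrnA. Qed.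

Lemma divides_additive (e : {additive G -> G}) n x :
  divides n x -> divides n (e x).
Proof. by move=> [w ->]; exists (e w); rewrite raddfMn. Qed.

Lemma coprime_bezout n k : coprimez n k ->
  exists u v : int, forall x, x = x *~ u *+ n + x *~ v *~ k.
Proof.
move=> /coprimezP[[u v] /= uv]; exists u, v => x.
by rewrite pmulrn -!mulrzA -mulrzDr uv.
Qed.

Lemma divides_coprimeMz n k x :
  coprimez n k -> divides n (x *~ k) -> divides n x.
Proof.
move=> /coprime_bezout[u [v uv]] nkx; rewrite (uv x); apply: dividesD.
  by exists (x *~ u).
by rewrite -mulrzA mulrC mulrzA; exact: dividesMz.
Qed.

Lemma divides_coprime n m x : coprime n m ->
  divides n x -> divides m x -> divides (n * m) x.
Proof.
move=> nm [w xw] [w' xw']; have /coprime_bezout[u [v uv]] : coprimez n m by [].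
exists (w' *~ u + w *~ v); rewrite mulrnDl (uv x) {1}xw' xw; congr (_ + _).
  by rewrite !pmulrn -!mulrzA; congr (_ *~ _); rewrite PoszM; ring.
by rewrite !pmulrn -!mulrzA; congr (_ *~ _); rewrite PoszM; ring.
Qed.


Hypothesis tfG : torsion_free G.

Lemma mulrn_injr n : (0 < n)%N -> injective (fun x : G => x *+ n).
Proof.
move=> n_gt0 x y /= xy; apply/subr0_eq/(tfG n_gt0).
by rewrite mulrnBl xy subrr.
Qed.

Lemma mulrz_eq0_tf x k : x *~ k = 0 -> x = 0 \/ k = 0.
Proof.
case: k => [[|n]|n]; [by right| |]; first by move=> /tfG ->; [left|].
by rewrite NegzE mulrNz => /eqP; rewrite oppr_eq0 => /eqP /tfG ->; [left|].
Qed.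

Lemma divides_transfer x z k n : (forall m, divides m x -> divides m z) ->
  divides n (x *~ k) -> divides n (z *~ k).
Proof.
move=> xz; have [->|k_neq0] := eqVneq k 0; first by rewrite !mulr0z.
move=> [w kxw];
  have g_gt0 : (0 < gcdn n `|k|)%N by rewrite gcdn_gt0 absz_gt0 k_neq0 orbT.
set g := gcdn n `|k| in g_gt0.
have /dvdnP[n' n_g] : (g %| n)%N by exact: dvdn_gcdl.
have /dvdzP[k' k_g] : (g%:Z %| k)%Z by exact: dvdn_gcdr.
have nk' : coprimez n' k'.
  rewrite /coprimez /gcdz eqz_nat -(eqn_pmul2r g_gt0) muln_gcdl -n_g mul1n.
  by rewrite -[X in (_ * X)%N]/(`|g%:Z|%N) -abszM -k_g.
have /xz[w' ->] : divides n' x.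
  apply: (@divides_coprimeMz _ k') => //; exists w; apply: (mulrn_injr g_gt0).
  by rewrite /= -mulrnA -n_g -kxw k_g mulrzA.
by exists (w' *~ k'); rewrite n_g k_g !pmulrn -!mulrzA; congr (_ *~ _);
  rewrite PoszM; ring.
Qed.

Lemma divides_absz n x k : divides n (x *~ k) -> divides n (x *+ `|k|%N).
Proof.
case: k => m //; rewrite NegzE mulrNz => /(@dividesMz _ _ (-1)).
by rewrite mulrN1z opprK.
Qed.

Definition type_le x y := exists2 m, (0 < m)%N &
  forall n, divides n x -> divides n (y *+ m).

Lemma type_le_refl x : type_le x x.
Proof. by exists 1%N. Qed.

Lemma type_le_trans x y z : type_le x y -> type_le y z -> type_le x z.
Proof.
move=> [k k_gt0 xy] [l l_gt0 yz]; exists (l * k)%N => [|n /xy nky].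
  by rewrite muln_gt0 l_gt0.
by rewrite mulrnA; exact: (@divides_transfer y (z *+ l) k%:Z n yz nky).
Qed.

Lemma type_le0 x : type_le x 0.
Proof. by exists 1%N => // n _; exact: divides0. Qed.

Lemma type_leD x y z : type_le x y -> type_le x z -> type_le x (y + z).
Proof.
move=> [k k_gt0 xy] [l l_gt0 xz]; exists (k * l)%N;
  first by rewrite muln_gt0 k_gt0.
move=> n nx; rewrite mulrnDl; apply: dividesD.
  by rewrite mulrnA; exact/dividesMn/xy.
by rewrite mulnC mulrnA; exact/dividesMn/xz.
Qed.

Lemma type_le_additive (e : {additive G -> G}) x y :
  type_le x y -> type_le x (e y).
Proof.
by move=> [k k_gt0 xy]; exists k => // n /xy /(divides_additive e);
  rewrite raddfMn.
Qed.

Definition line x := [set a | exists n, (0 < n)%N /\ exists k, a *+ n = x *~ k].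

Lemma line_refl x : line x x.
Proof. by exists 1%N; split=> //; exists 1. Qed.

Lemma line_subgroup x : is_subgroup (line x).
Proof.
apply/is_subgroupP; split.
  by exists 1%N; split=> //; exists 0; rewrite mul0rn mulr0z.
move=> a b [n [n0 [k ak]]] [m [m0 [l bl]]].
exists (n * m)%N; split; first by rewrite muln_gt0 n0.
exists (k * m - l * n); rewrite mulrnBl mulrnA ak mulnC mulrnA bl.
by rewrite mulrzBr !mulrzA.
Qed.

Lemma line_pure x n a : (0 < n)%N -> line x (a *+ n) -> line x a.
Proof.
move=> n0 [m [m0 [k ak]]]; exists (n * m)%N; split;
  first by rewrite muln_gt0 n0.
by exists k; rewrite mulrnA.
Qed.

Lemma line_sym x y a : x != 0 -> line y x -> line y a -> line x a.
Proof.
move=> x_neq0 [n [n0 [k xk]]] [m [m0 [l al]]].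
have k_neq0 : k != 0.
  by apply: contra_neq x_neq0 => k0; apply: (tfG n0); rewrite xk k0 mulr0z.
have [s absk] : exists s, `|k|%N%:Z = k * s.
  by have [k0|k0] := leP 0 k; [exists 1|exists (-1)]; lia.
apply: (@line_pure _ (m * `|k|)%N); first by rewrite muln_gt0 m0 absz_gt0.
exists 1%N; split=> //; exists (n%:Z * (s * l)).
rewrite mulr1n mulrnA al mulrzA -[x *~ n]/(x *+ n) xk pmulrn absk -!mulrzA.
by congr (_ *~ _); ring.
Qed.

Lemma extend_along (u : {additive G -> G}) x z : x != 0 ->
  (forall n, divides n x -> divides n z) -> (forall g, line x (u g)) ->
  exists h : {additive G -> G},
    forall g n k, (0 < n)%N -> u g *+ n = x *~ k -> h g *+ n = z *~ k.
Proof.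
move=> x_neq0 xz lxu.
have trans g b n k n' k' : (0 < n)%N -> (0 < n')%N -> u g *+ n = x *~ k ->
    u g *+ n' = x *~ k' -> b *+ n = z *~ k -> b *+ n' = z *~ k'.
  move=> n0 n'0 uk uk' bk.
  have kn' : k * n' = k' * n.
    apply/eqP; rewrite -subr_eq0; apply/eqP.
    have : x *~ (k * n' - k' * n) = 0.
      rewrite mulrzBr !mulrzA -uk -uk' !pmulrn -!mulrzA mulrC; exact: subrr.
    by move=> /mulrz_eq0_tf[] // x0; rewrite x0 eqxx in x_neq0.
  apply: (mulrn_injr n0); rewrite /= -mulrnA mulnC mulrnA bk.
  by rewrite !pmulrn -!mulrzA kn'.
have /choice[h hP] g : exists b, forall n k, (0 < n)%N -> u g *+ n = x *~ k ->
    b *+ n = z *~ k.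
  have [n [n0 [k uk]]] := lxu g.
  have [|b bk] := @divides_transfer x z k n xz; first by exists (u g).
  by exists b => n' k' n'0 uk'; exact: (trans g b n k).
have [|f fh] := @additive_of_morphism _ h; last first.
  by exists f => g n k n0 uk; rewrite fh; exact: hP.
move=> g g'; have [n [n0 [k uk]]] := lxu g; have [n' [n'0 [k' uk']]] := lxu g'.
have nn'0 : (0 < n * n')%N by rewrite muln_gt0 n0.
apply: (mulrn_injr nn'0); rewrite /= mulrnBl.
have uk1 : u g *+ (n * n') = x *~ (k * n') by rewrite mulrnA uk mulrzA.
have uk2 : u g' *+ (n * n') = x *~ (k' * n) by rewrite mulnC mulrnA uk' mulrzA.
rewrite (hP _ _ _ nn'0 uk1) (hP _ _ _ nn'0 uk2) -mulrzBr; apply: hP => //.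
by rewrite raddfB mulrnBl uk1 uk2 mulrzBr.
Qed.

Lemma line_rank_one x : x != 0 -> rank_one (line x).
Proof.
move=> x_neq0; exists x; split.
- by move=> _ ->; exact: line_refl.
- move=> s c us sx sum0 y sy.
  have s_x : perm_eq s [:: x].
    apply: uniq_perm => // z; rewrite inE; apply/idP/eqP => [/sx //|->].
    by rewrite -(sx _ sy).
  move: sum0; rewrite (perm_big _ s_x) big_seq1 (sx _ sy).
  by move=> /mulrz_eq0_tf[] // x0; rewrite x0 eqxx in x_neq0.
move=> C xC Clx indC; apply/seteqP; split=> // y Cy; apply: contrapT => y_x.
have [n [n0 [k yk]]] := Clx _ Cy.
pose c z : int := if z == x then - k else n%:Z.
have : c y = 0.
  apply: (indC [:: x; y]); last by rewrite !inE eqxx orbT.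
  - by rewrite /= inE andbT; apply/eqP => xy; apply: y_x; rewrite xy.
  - by move=> z; rewrite !inE => /orP[]/eqP-> //; exact: xC.
  rewrite !big_cons big_nil /c eqxx ifN; last exact/eqP.
  by rewrite -[y *~ n]/(y *+ n) yk mulrNz addr0 addNr.
by rewrite /c ifN; [case: (n) n0|exact/eqP].
Qed.

End Divisibility.

Section Independence.
Variable G : zmodType.
Hypothesis tfG : torsion_free G.
Implicit Types (B C D E H P : set G) (x y z g : G).

Definition pure_subgroup P := is_subgroup P /\
  forall n x, (0 < n)%N -> P (x *+ n) -> P x.

Definition spanned D x := forall P, pure_subgroup P -> D `<=` P -> P x.

Lemma pure_subgroupMz P x k : pure_subgroup P -> k != 0 -> P (x *~ k) -> P x.
Proof.
move=> [sP pP]; case: k => [[|n]|n] // _; first exact: pP.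
by rewrite NegzE mulrNz => /(subgroupN sP); rewrite opprK; exact: pP.
Qed.

Lemma independentU1 D b :
  Z_independent D -> ~ spanned D b -> Z_independent (D `|` [set b]).
Proof.
move=> indD Db s c us sDb sum0.
have [bs|bs] := boolP (b \in s); last first.
  apply: (indD s c us) => // x xs; have [//|xb] := sDb _ xs.
  by rewrite -xb xs in bs.
have ur : uniq (rem b s) by exact: rem_uniq.
have rD x : x \in rem b s -> D x.
  rewrite mem_rem_uniq // !inE => /andP[/eqP xb xs].
  by have [//|/xb] := sDb _ xs.
move: sum0; rewrite (big_rem b) //= => sum0.
have cb0 : c b = 0.
  apply: contrapT => /eqP cb0; apply: Db => P pP DP.
  apply: (pure_subgroupMz pP cb0).
  have -> : b *~ c b = - \sum_(y <- rem b s) y *~ c y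
    by rewrite -(addr0_eq sum0) opprK.
  have [sP _] := pP; apply: subgroupN => //;
    apply: subgroup_sum => // x /rD /DP.
  exact: subgroupMz.
move=> x xs; have [->//|xb] := eqVneq x b.
move: sum0; rewrite cb0 mulr0z add0r => sum0.
by apply: (indD _ _ ur rD sum0); rewrite mem_rem_uniq // !inE xb.
Qed.

Lemma independent_not_spanned D E x :
  Z_independent D -> E `<=` D -> D x -> ~ E x -> ~ spanned E x.
Proof.
move=> indD ED Dx Ex spEx.
pose P := [set z | exists n s (f : G -> int), [/\ (0 < n)%N, uniq s,
  forall y, y \in s -> E y, forall y, y \notin s -> f y = 0 &
  z *+ n = \sum_(y <- s) y *~ f y]].
have [n [s [f [n0 us sE f0 xn]]]] : P x.
  apply: spEx; last first.
    move=> y Ey; exists 1%N, [:: y], (fun z => (z == y)%:Z); split=> //.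
    - by move=> z; rewrite inE => /eqP->.
    - by move=> z; rewrite inE => /negbTE->.
    - by rewrite big_seq1 eqxx.
  split; last first.
    move=> m z m0 [n [s [f [n0 us sE f0 zn]]]]; exists (m * n)%N, s, f;
      split=> //.
      by rewrite muln_gt0 m0.
    by rewrite mulrnA.
  apply/is_subgroupP; split.
    by exists 1%N, [::], (fun=> 0); split=> //; rewrite big_nil mul0rn.
  move=> y z [n [s [f [n0 us sE f0 yn]]]] [m [t [h [m0 ut tE h0 zm]]]].
  exists (n * m)%N, (undup (s ++ t)), (fun w => f w * m - h w * n); split.
  - by rewrite muln_gt0 n0.
  - exact: undup_uniq.
  - by move=> w; rewrite mem_undup mem_cat => /orP[/sE|/tE].
  - move=> w; rewrite mem_undup mem_cat negb_or => /andP[/f0-> /h0->].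
    by rewrite !mul0r subrr.
  under eq_bigr do rewrite mulrzBr.
  rewrite sumrB (@big_uniq_support _ _ s) ?undup_uniq //; first last.
  - by move=> w /f0->; rewrite mul0r mulr0z.
  - by move=> w; rewrite mem_undup mem_cat => ->.
  rewrite (@big_uniq_support _ _ t (undup _)) ?undup_uniq //; first last.
  - by move=> w /h0->; rewrite mul0r mulr0z.
  - by move=> w; rewrite mem_undup mem_cat orbC => ->.
  rewrite mulrnBl mulrnA yn [in z *+ _]mulnC mulrnA zm !pmulrn !mulrz_suml.
  by under eq_bigr do rewrite -mulrzA;
    under [X in _ - X]eq_bigr do rewrite -mulrzA.
have xs : x \notin s by apply/negP => /sE.
pose c y : int := if y == x then n%:Z else - f y.
have : c x = 0.
  apply: (indD (x :: s)); last exact: mem_head.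
  - by rewrite /= xs.
  - by move=> y; rewrite inE => /predU1P[->//|/sE /ED].
  rewrite big_cons /c eqxx big_seq (eq_bigr (fun y => - (y *~ f y))).
    by rewrite sumrN -big_seq -xn -[x *~ n]/(x *+ n) subrr.
  move=> y ys; rewrite ifN ?mulrNz //; apply: contraNneq xs => <-.
  exact: ys.
by rewrite /c eqxx; case: (n) n0.
Qed.

Lemma maximal_independent_spanned H B x :
  maximal_independent H B -> H x -> spanned B x.
Proof.
move=> [BH indB maxB] Hx; apply: contrapT => nBx.
suff : B x by move=> Bx; apply: nBx => P _; exact.
rewrite -(maxB (B `|` [set x])).
- by right.
- by left.
- by move=> y [/BH|->].
- exact: independentU1.
Qed.

Lemma rank_one_line H x a : is_subgroup H -> rank_one H -> x != 0 ->
  H x -> H a -> line x a.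
Proof.
move=> sH [y maxy] x0 Hx Ha.
have pureL : pure_subgroup (line y).
  by split=> [|n z]; [exact: line_subgroup|exact: line_pure].
have L z : H z -> line y z.
  move=> /(maximal_independent_spanned maxy); apply=> //.
  by move=> _ ->; exact: line_refl.
by apply: (line_sym _ x0 (L _ Hx) (L _ Ha)).
Qed.

(* Zorn's lemma on the partial injections from [C] to [B] that may replace
   their domain in [C] by their range without spoiling independence. *)
Lemma card_le_maximal_independent H B C :
  maximal_independent H B -> Z_independent C -> C `<=` H -> C #<= B.
Proof.
move=> maxB indC CH.
pose swap (R : set (G * G)) :=
  [set x | (C x /\ forall u, R u -> u.1 <> x) \/ exists2 u, R u & u.2 = x].
pose exch (R : set (G * G)) := [/\ forall u, R u -> C u.1 /\ B u.2,
  forall u v, R u -> R v -> u.1 = v.1 -> u = v,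
  forall u v, R u -> R v -> u.2 = v.2 -> u = v,
  forall u, R u -> C u.2 -> exists2 v, R v & v.1 = u.2 &
  Z_independent (swap R)].
have exch0 : exch set0.
  split=> //; move=> s c us sC; apply: indC => // x /sC[[]//|[]//].
have [F Fexch Ftot|R [exchR maxR]] := @Zorn_bigcup _ exch.
  have Ftot2 u v : (\bigcup_(X in F) X) u -> (\bigcup_(X in F) X) v ->
      exists X, [/\ F X, X u & X v].
    move=> [X FX Xu] [Y FY Yv]; have [XY|YX] := Ftot _ _ FX FY.
      by exists Y; split=> //; exact: XY.
    by exists X; split=> //; exact: YX.
  split.
  - by move=> u [X /Fexch[+ _ _ _ _] Xu]; exact.
  - by move=> u v /Ftot2 uv /uv[X [/Fexch[_ + _ _ _] Xu Xv]]; exact.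
  - by move=> u v /Ftot2 uv /uv[X [/Fexch[_ _ + _ _] Xu Xv]]; exact.
  - move=> u [X FX Xu] Cu; have [_ _ _ + _] := Fexch _ FX.
    by move=> /(_ _ Xu Cu)[v Xv vu]; exists v => //; exists X.
  move=> s c us sR.
  have [X [exX sX]] : exists X, (X = set0 \/ F X) /\
      forall x, x \in s -> (C x /\
        forall u, (\bigcup_(X in F) X) u -> u.1 <> x) \/
                           exists2 u, X u & u.2 = x.
    elim: s {us} sR => [|x s IHs] sR; first by exists set0; split=> //; left.
    have [|X [FX sX]] := IHs; first by move=> y ys; apply: sR;
      rewrite inE ys orbT.
    have [Cx|[u [Y FY Yu] ux]] := sR x (mem_head _ _).
      by exists X; split=> // y; rewrite inE => /predU1P[->|/sX//]; left.
    have [XY|YX] : X `<=` Y \/ Y `<=` X.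
      by case: FX => [->|FX]; [left|exact: Ftot].
      exists Y; split; first by right.
      move=> y; rewrite inE => /predU1P[->|/sX[|[v Xv vy]]]; [|by left|].
        by right; exists u.
      by right; exists v => //; exact: XY.
    exists X; split=> // y; rewrite inE => /predU1P[->|/sX//].
    by right; exists u => //; exact: YX.
  have [_ _ _ _ indX] : exch X by case: exX => [->//|/Fexch].
  apply: indX us _ => x /sX[[Cx nx]|]; last by right.
  case: exX => [X0|FX]; left; split=> // u; first by rewrite X0.
  by move=> Xu; apply: nx; exists X.
have [RCB Rfun Rinj Rdisj indR] := exchR.
have domR c : C c -> exists2 u, R u & u.1 = c.
  move=> Cc; apply: contrapT => nc.
  have nRc u : R u -> u.1 <> c by move=> Ru uc; apply: nc; exists u.
  pose D := swap R `\` [set c].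
  have swapc : swap R c by left.
  have Dc : ~ spanned D c.
    apply: (independent_not_spanned indR) => //; first by move=> x [].
    by move=> [_]; apply.
  have [b Bb Db] : exists2 b, B b & ~ spanned D b.
    apply: contrapT => nb; apply: Dc => P pP DP.
    apply: (maximal_independent_spanned maxB (CH _ Cc)) => // b Bb.
    by apply: contrapT => Pb; apply: nb; exists b => // /(_ P pP DP).
  have spD x : D x -> spanned D x by move=> Dx P _; exact.
  have ranD u : R u -> D u.2.
    move=> Ru; split; first by right; exists u.
    move=> uc; have [|v Rv] := Rdisj _ Ru; first by rewrite uc.
    by rewrite uc; exact: nRc.
  have Rb u : R u -> u.2 <> b by move=> /ranD /spD + ub; rewrite ub.
  pose R' := R `|` [set (c, b)].
  have [|] := maxR R'.
    split=> [u Ru|RR]; first by left.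
    by apply: (nRc (c, b)) => //; apply: RR; right.
  split.
  - by move=> u [/RCB//|->].
  - move=> u v [Ru|->] [Rv|->] //=; [exact: Rfun|by move=> /(nRc _ Ru)|].
    by move=> /esym /(nRc _ Rv).
  - move=> u v [Ru|->] [Rv|->] //=; [exact: Rinj|by move=> /(Rb _ Ru)|].
    by move=> /esym /(Rb _ Rv).
  - move=> u [Ru Cu|->/= Cb].
      by have [v Rv vu] := Rdisj _ Ru Cu; exists v => //; left.
    have [->|bc] := pselect (b = c); first by exists (c, b) => //; right.
    apply: contrapT => nv; apply: Db; apply: spD; split; last exact: bc.
    left; split=> // v Rv vb.
    by apply: nv; exists v => //; left.
  have -> : swap R' = D `|` [set b]; last first.
    apply: independentU1 => // s d us sD; apply: indR => // x /sD; by case.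
  apply/seteqP; split=> x.
    move=> [[Cx nx]|[u [Ru|->] <-]]; [left|by left; exact: ranD|by right].
    split; first by left; split=> // u Ru; apply: nx; left.
    by move=> /= xc; apply: (nx (c, b)); [right|].
  move=> [[[[Cx nx]|[u Ru ux]] xc]|->]; last by right; exists (c, b); [right|].
    by left; split=> // u [/nx//|-> /esym].
  by right; exists u => //; left.
have /choice[f fP] c : exists b, C c -> R (c, b).
  have [/domR[[c' b] Rcb /= <-]|nC] := pselect (C c); first by exists b.
  by exists 0 => /nC.
have f_inj : {in C &, injective f}.
  move=> c c' /set_mem/fP Rc /set_mem/fP Rc' ff.
  by have [] := Rinj _ _ Rc Rc' ff.
have /card_eqPle[_ Cf] := inj_card_eq f_inj.
apply: (card_le_trans Cf); apply: subset_card_le => _ [c /fP Rc <-].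
by case: (RCB _ Rc).
Qed.
End Independence.

Section Decompositions.
Variable G : zmodType.
Hypothesis tfG : torsion_free G.
Implicit Types (A B C H : set G) (x y z g v : G).

Lemma type_le_bezout (I : eqType) (T : seq I) (y : I -> G) v :
  uniq T -> T != [::] -> (forall j, j \in T -> y j != 0) ->
  (forall j, j \in T -> type_le (y j) v) ->
  (forall n, (forall j, j \in T -> divides n (y j)) -> divides n v) ->
  exists2 q : I -> int, \sum_(j <- T) q j = 1 &
    forall j, j \in T -> forall n, divides n (y j) -> divides n (v *~ q j).
Proof.
move=> uT T0 y0 le_yv div_v.
pose J j (k : int) := forall n, divides n (y j) -> divides n (v *~ k).
pose K k := exists2 q : I -> int,
  \sum_(j <- T) q j = k & forall j, j \in T -> J j (q j).
suff [q] : K 1 by exists q.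
apply: int_subgroup_1 => [_ _ [q <- qJ] [r <- rJ]|p p_prime].
  exists (fun j => q j - r j); first by rewrite sumrB.
  by move=> j jT n nyj; rewrite mulrzBr; apply: dividesB; [exact: qJ|exact: rJ].
have [j jT pj] : exists2 j, j \in T &
    forall b, divides (p ^ b) (y j) -> divides (p ^ b) v.
  have [pv|/existsNP[b0 nb0]] := pselect (forall b, divides (p ^ b) v).
    by case: T T0 => // j T _ in uT y0 le_yv div_v K *; exists j;
      rewrite ?mem_head.
  have ex_b : exists b, `[< ~ divides (p ^ b) v >] by exists b0; exact/asboolP.
  case: (ex_minnP ex_b) => b /asboolP pbv b_min.
  have [j jT npbj] : exists2 j, j \in T & ~ divides (p ^ b) (y j).
    apply: contrapT => npb; apply/pbv/div_v => j jT.
    by apply: contrapT => pbj; apply: npb; exists j.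
  exists j => // b' pb'j; apply: contrapT => /asboolP/b_min bb'.
  by apply/npbj/(divides_dvdn _ pb'j)/dvdn_exp2l.
have [m m0 mJ] := le_yv j jT.
pose k := (m`_p^')%N.
have pk : coprime p k by rewrite prime_coprime // -p'natE // part_pnat.
exists k%:Z; last by rewrite /dvdz /= -prime_coprime.
exists (fun i => if i == j then k%:Z else 0).
  by rewrite (bigD1_seq j) //= eqxx big1 ?addr0 // => i /negbTE ->.
move=> i iT n; have [->|_ _] := eqVneq i j; last by rewrite mulr0z;
  exact: divides0.
move=> nyj; have n0 : (0 < n)%N.
  case: n nyj => // -[w yw]; have := y0 j jT.
  by rewrite yw mulr0n eqxx.
rewrite -(partnC p n0); apply: divides_coprime; first exact: coprime_partC.
  rewrite p_part; apply/dividesMn/pj; rewrite -p_part.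
  exact: divides_dvdn (dvdn_part _ _) nyj.
apply: (@divides_coprimeMz _ _ (m`_p)%N);
  first by rewrite coprimezE /= coprime_sym coprime_partC.
have /mJ := divides_dvdn (dvdn_part p^' n) nyj.
by rewrite -{1}(partnC p m0) mulnC mulrnA.
Qed.

Lemma retraction_not_clipped A H v (h : {additive G -> G}) :
  direct_sum A H [set: G] -> H v -> v != 0 -> h v = v ->
  (forall g, line v (h g)) -> ~ clipped H.
Proof.
move=> GAH Hv v0 hv lh; apply; have [sA sH AH _] := GAH.
have [e [_ He eA eH]] := direct_sum_proj GAH.
have lH g : line v g -> H g.
  move=> [n [n0 [k gk]]]; rewrite -[g](subr0 g).
  suff <- : e g = 0 by [].
  by apply: (tfG n0); rewrite -raddfMn gk raddfMz /= eH // mul0rz.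
have hl g : line v g -> h g = g.
  move=> [n [n0 [k gk]]]; apply: (mulrn_injr tfG n0).
  by rewrite /= -raddfMn gk raddfMz /= hv.
exists (line v), (H `&` [set g | h g = 0]); split; last exact: line_rank_one.
split; first exact: line_subgroup.
- apply/is_subgroupP; split; first by split; [exact: subgroup0|exact: raddf0].
  move=> a b [Ha /= ha] [Hb /= hb]; split; first exact: subgroupB.
  by rewrite /= raddfB ha hb subrr.
- apply/seteqP; split=> [g [/hl hg [_ /=]]|_ ->]; first by rewrite hg.
  split; first by have /subgroup0 := line_subgroup v.
  by split; [exact: subgroup0|exact: raddf0].
apply/seteqP; split=> [g Hg|_ [a la [b [Hb _]] <-]]; last first.
  by apply: subgroupD => //; exact: lH.
exists (h g) => //; exists (g - h g); last by rewrite addrC subrK.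
split; first by apply: subgroupB => //; exact: lH.
by rewrite /= raddfB (hl (h g)) // subrr.
Qed.

Lemma completely_decomposable_cap_clipped A H A' H' x :
  direct_sum A H [set: G] -> completely_decomposable A ->
  direct_sum A' H' [set: G] -> clipped H' -> A x -> H' x -> x = 0.
Proof.
move=> GAH [I [F [rF FA]]] GAH' clH' Ax H'x.
apply: contrapT => /eqP x0; have [sF _ _] := FA.
have [e [H'e _ eH' _]] := direct_sum_proj (direct_sumC GAH').
have [c [Fc /(_ _ Ax)[s0 [us0 _ xs0]]]] := direct_sum_family_proj GAH FA.
pose s := [seq i <- s0 | c i x != 0].
have xs : x = \sum_(i <- s) c i x.
  rewrite {1}xs0 big_filter [RHS]big_mkcond; apply: eq_bigr => i _.
  by case: eqVneq.
have s_neq0 i : i \in s -> c i x != 0 by rewrite mem_filter => /andP[].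
pose le i j := type_le (c i x) (c j x).
have le_trans i j k : le i j -> le j k -> le i k by exact: type_le_trans.
have [|i si i_min] := @exists_minimal _ le s (fun i => type_le_refl _) le_trans.
  by apply: contraNneq x0 => s_nil; rewrite xs s_nil big_nil.
pose T := [seq j <- s | `[< le j i >]].
have TP j : j \in T -> j \in s /\ le j i by rewrite mem_filter =>
  /andP[/asboolP].
have Ti : i \in T by rewrite mem_filter si andbT; apply/asboolP;
  exact: type_le_refl.
pose v := e (\sum_(j <- T) c j x).
have cv k : k \in T -> c k v = c k x.
  move=> /TP[sk le_ki].
  rewrite -[in RHS](eH' _ H'x) [in RHS]xs /v big_filter !raddf_sum /=.
  rewrite big_mkcond /=; apply/eq_big_seq => j sj.
  case: asboolP => // nle_ji; apply/esym/eqP; apply: contra_notT nle_ji => cek0.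
  apply: le_trans le_ki.
  have [n [n0 [l ekl]]] :=
    rank_one_line tfG (sF k) (rF k) (s_neq0 _ sk) (Fc k x) (Fc k (e (c j x))).
  have l0 : l != 0.
    by apply: contraNneq cek0 => l0; apply/eqP/(tfG n0); rewrite ekl l0 mulr0z.
  exists `|l|%N; first by rewrite absz_gt0.
  move=> m /(divides_additive e)/(divides_additive (c k))/(dividesMn n).
  by rewrite ekl; exact: divides_absz.
have v0 : v != 0 by apply: contraNneq (s_neq0 _ si) => v0;
  rewrite -(cv _ Ti) v0 raddf0.
have [|||||q q1 qP] := @type_le_bezout _ T (fun j => c j x) v.
- by rewrite !filter_uniq.
- by apply/eqP => T0; rewrite T0 in Ti.
- by move=> j /TP[/s_neq0].
- move=> j /TP[sj le_ji]; apply: type_le_additive.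
  rewrite big_seq; apply: big_ind => [|y z|k /TP[sk le_ki]].
  + exact: type_le0.
  + exact: type_leD.
  + exact: le_trans le_ji (i_min _ sk le_ki).
- by move=> n nT; apply/divides_additive/divides_sum.
have /choice[h hP] j : exists h : {additive G -> G}, j \in T -> forall g n k,
    (0 < n)%N -> c j g *+ n = c j x *~ k -> h g *+ n = v *~ q j *~ k.
  have [jT|] := boolP (j \in T); last by exists idfun.
  have [sj _] := TP _ jT.
  have [g|h hP] := extend_along tfG (u := c j) (s_neq0 _ sj) (qP _ jT).
    exact: rank_one_line (s_neq0 _ sj) _ _.
  by exists h.
have [|f fE] := @additive_of_morphism _ (fun g => \sum_(j <- T) h j g).
  by move=> a b; rewrite -sumrB; apply: eq_bigr => j _; rewrite raddfB.
apply: (@retraction_not_clipped A' H' v f) clH' => //; first exact: H'e.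
  rewrite fE -[RHS]mulr1z -q1 mulrz_sumr; apply: eq_big_seq => j jT.
  by apply: (hP j jT v 1%N 1) => //; rewrite cv.
move=> g; rewrite fE; apply: subgroup_sum; first exact: line_subgroup.
move=> j jT; have [sj _] := TP _ jT.
have [n [n0 [k ck]]] :=
  rank_one_line tfG (sF j) (rF j) (s_neq0 _ sj) (Fc j x) (Fc j g).
exists n; split=> //; exists (q j * k); rewrite mulrzA.
exact: hP.
Qed.

Lemma Z_independent_image H B (p : {additive G -> G}) : is_subgroup H ->
  (forall x, H x -> p x = 0 -> x = 0) -> B `<=` H -> Z_independent B ->
  Z_independent (p @` B).
Proof.
move=> sH p0 BH indB s c us sB sum0.
have /choice[r rP] x : exists y, x \in s -> B y /\ p y = x.
  have [/sB[y By yx]|] := boolP (x \in s); first by exists y.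
  by exists 0.
have rB x : x \in s -> B (r x) by move=> /rP[].
have pr x : x \in s -> p (r x) = x by move=> /rP[].
have sum_r : \sum_(y <- map r s) y *~ c (p y) = 0.
  apply: p0.
    apply: subgroup_sum => // _ /mapP[x xs ->].
    by apply: subgroupMz => //; exact/BH/rB.
  rewrite raddf_sum big_map -[RHS]sum0; apply: eq_big_seq => x xs.
  by rewrite /= raddfMz /= pr.
move=> x xs; rewrite -(pr x xs).
apply: (indB (map r s) (c \o p)) => //.
- by rewrite map_inj_in_uniq // => y z /pr {2}<- /pr {2}<- ->.
- by move=> _ /mapP[y ys ->]; exact: rB.
- exact: map_f.
Qed.

Lemma card_le_clipped A H A' H' B B' :
  direct_sum A H [set: G] -> completely_decomposable A ->
  direct_sum A' H' [set: G] -> clipped H' ->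
  maximal_independent H' B' -> maximal_independent H B -> B' #<= B.
Proof.
move=> GAH cdA GAH' clH' [B'H' indB' _] maxB.
have [p [Hp pA pH _]] := direct_sum_proj (direct_sumC GAH).
have [_ sH' _ _] := GAH'.
have p_inj x : H' x -> p x = 0 -> x = 0.
  move=> H'x px; have Ax : A x by have := pA x; rewrite px subr0.
  exact: completely_decomposable_cap_clipped GAH cdA GAH' clH' Ax H'x.
have ind_pB' := Z_independent_image sH' p_inj B'H' indB'.
have pB'_inj : {in B' &, injective p}.
  move=> x y /set_mem/B'H' H'x /set_mem/B'H' H'y pxy; apply/subr0_eq/p_inj.
    exact: subgroupB.
  by rewrite raddfB pxy subrr.
have /card_eqPle[_ B'p] := inj_card_eq pB'_inj.
apply: (card_le_trans B'p).
by apply: (card_le_maximal_independent maxB ind_pB') => _ [x _ <-].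
Qed.

End Decompositions.

Theorem theorem2p13 (G : zmodType) (A H A' H' : set G)
  (G_infinite : infinite_set [set: G])
  (G_torsion_free : torsion_free G)
  (G_AH : direct_sum A H [set: G])
  (A_cd : completely_decomposable A)
  (H_clipped : clipped H)
  (G_AH' : direct_sum A' H' [set: G])
  (A_cd' : completely_decomposable A')
  (H_clipped' : clipped H') :
  same_rank H' H.
Proof.
move=> B' B maxB' maxB; apply: Cantor_Bernstein.
  exact: (card_le_clipped _ G_AH A_cd G_AH').
exact: (card_le_clipped _ G_AH' A_cd' G_AH).
Qed.
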